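(* Let $d$ be a fixed positive integer. Let $(p_n)_{n\ge 1}$ be a sequence of odd primes, $(\ell_n)_{n\ge 1}$ a sequence of positive integers, put $q_n = p_n^{\ell_n}$, and let $E_n \subset \mathbb{Z}_{q_n}^d$ be sets such that $|E_n| \gg \ell_n\, q_n^{\frac{(2\ell_n-1)d}{2\ell_n} + \frac{1}{2\ell_n}}$, i.e. $$\frac{\ell_n\, q_n^{\frac{(2\ell_n-1)d}{2\ell_n} + \frac{1}{2\ell_n}}}{|E_n|} \longrightarrow 0 \quad \text{as } n\to\infty .$$ Then for all sufficiently large $n$, $$\prod(E_n) \supset \mathbb{Z}_{q_n}^{\times}.$$
   Context: For a positive integer $q$, $\mathbb{Z}_q = \mathbb{Z}/q\mathbb{Z}$ is the ring of integers modulo $q$ and $\mathbb{Z}_q^{\times}$ is its group of units. For $x,y \in \mathbb{Z}_q^d$, $x\cdot y = x_1y_1 + \dots + x_dy_d \in \mathbb{Z}_q$ is the usual dot product. For $E \subset \mathbb{Z}_q^d$, the dot-product set is $\prod(E) = \{x\cdot y : x,y\in E\} \subset \mathbb{Z}_q$. The notation $X \gg Y$ means $Y = o(X)$. *)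

(* Defs.v *)
From HB Require Import structures.
From mathcomp Require Import all_boot all_order all_algebra.
From mathcomp Require Import all_classical all_reals all_analysis.

Set Implicit Arguments.
Unset Strict Implicit.
Unset Printing Implicit Defensive.

Import GRing.Theory.
Local Open Scope ring_scope.

(* 'Z_q is the ring of integers modulo q only when 1 < q ('Z_0 and 'Z_1 are both
   Z/2Z), so these notions are meaningful under that assumption, which holds for
   q = p ^ l with p prime and 0 < l. *)
Definition dotp (q d : nat) (x y : 'rV['Z_q]_d) : 'Z_q :=
  \sum_(i < d) x 0 i * y 0 i.

Definition dotp_set (q d : nat) (E : {set 'rV['Z_q]_d}) : {set 'Z_q} :=
  [set dotp x y | x in E, y in E]%SET.

(* Main.v *)
Require Import Defs.
From HB Require Import structures.
From mathcomp Require Import all_boot all_order all_algebra.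
From mathcomp Require Import all_classical all_reals all_analysis.
From mathcomp Require Import zify ring lra.
Set Implicit Arguments.
Unset Strict Implicit.
Unset Printing Implicit Defensive.
Import numFieldNormedType.Exports.
Local Open Scope classical_set_scope.
Local Open Scope ring_scope.
Import Order.TTheory GRing.Theory Num.Theory.

(** Put q = p ^ l and T = (Z/q)^d, and suppose that a unit t is not a dot
product of two elements of E.  The theorem follows from the finite bound
[card_avoiding]: |E|^2 <= (2 l)^2 p^((2l-1)d+1).  Indeed
Y = l q^(((2l-1)d+1)/(2l)) satisfies Y^2 = l^2 p^((2l-1)d+1), so the bound says
|E| <= 2 Y, whereas the hypothesis gives Y <= |E| / 4 for large n.

The finite bound is a second-moment argument, carried out by counting
instead of Fourier analysis.  Call a vector primitive if one of its coordinates
is a unit, and let A be the set of primitive vectors of E.  The other vectors of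
E are multiples of p, so there are at most p^((l-1)d) of them, which is
negligible.  For x in T let r(x) be the number of y in A with x.y = t.  A
primitive y has q^(d-1) solutions x of x.y = t, so the mean of r over T is
|A|/q; but r vanishes on A, which forces r to have a large variance
([second_moment]).

The variance is bounded above by counting the common solutions of x.y = t and
x.z = t, for y and z in A.  If z - y = p^j w with w primitive and j < l, the
second equation becomes p^j (x.w) = 0.  Whenever there is a common solution x0,
the product x0.w is divisible by p while x0.y = t is a unit: this forces y and w
to be independent modulo p, so the pair (x.y, x.w) is equidistributed in
(Z/q)^2 and there are exactly q^(d-2) p^j common solutions
([card_common_fiber] proves the upper bound).  Pairs with j = 0 thus have
nonpositive covariance, and only the pairs congruent modulo p can add to the
variance.  For a given y at most p^((l-k)d) vectors are congruent to y modulo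
p^k, and p^k p^((l-k)d) <= p^((l-1)d+1) for k >= 1; summing over 1 <= k <= l
yields |A|^2 <= l p^((2l-1)d+1). *)

(** * A second-moment inequality for bipartite graphs *)

(** If every y in A has #|T| / q neighbours, then the number r x of neighbours
of x in A has mean #|A| / q; it vanishes on A, so the sum of (q r(x) - #|A|)^2
over T is at least #|A|^3.  Expanding the square gives the inequality. *)
Lemma second_moment (T : finType) (A : {set T}) (e : rel T) (q : nat) :
    (forall y, y \in A -> q * #|[set x | e x y]%SET| = #|T|)%N ->
    {in A &, forall x y, ~~ e x y} ->
  (#|A| ^ 3 + #|A| ^ 2 * #|T| <=
     q ^ 2 * \sum_(y in A) \sum_(z in A) #|[set x | e x y && e x z]%SET|)%N.
Proof.
move=> regular isolated.
pose r x := (\sum_(y in A) e x y)%N.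
have sum_r : (q * \sum_x r x = #|A| * #|T|)%N.
  rewrite exchange_big big_distrr /= -sum_nat_const; apply: eq_bigr => y Ay.
  rewrite -(regular y Ay) -sum1dep_card [in RHS]big_mkcond.
  by congr muln; apply: eq_bigr => x _; case: (e x y).
have sum_r2 : (\sum_x r x ^ 2 =
    \sum_(y in A) \sum_(z in A) #|[set x | e x y && e x z]%SET|)%N.
  under eq_bigr => x _ do rewrite /r expnS expn1 big_distrlr /=.
  rewrite exchange_big; apply: eq_bigr => y _.
  rewrite exchange_big; apply: eq_bigr => z _.
  rewrite -sum1dep_card [RHS]big_mkcond; apply: eq_bigr => x _ /=.
  by case: (e x y); case: (e x z).
(* This is 0 <= (q r(x) - #|A|)^2, made an equality on A, where r(x) = 0. *)
have pointwise x : ((x \in A) * #|A| ^ 2 + 2 * #|A| * (q * r x) <=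
    q ^ 2 * r x ^ 2 + #|A| ^ 2)%N.
  have [Ax | _] := boolP (x \in A); last first.
    by rewrite mul0n add0n -mulnA addnC -expnMn nat_Cauchy.
  rewrite (_ : r x = 0%N); first by lia.
  by apply: big1 => y Ay; rewrite (negbTE (isolated x y Ax Ay)).
have := leq_sum (index_enum T) (fun x (_ : xpredT x) => pointwise x).
rewrite !big_split /= -big_distrl /= -!big_distrr /= sum_r sum_r2 sum_nat_const.
rewrite (_ : \sum_x (x \in A) = #|A|)%N; last first.
  by rewrite -sum1_card [RHS]big_mkcond.
rewrite (_ : #|(fun=> true : bool)| = #|T|); last by apply: eq_card.
by nia.
Qed.

(** * Dot products with primitive vectors *)

Definition primitive (q d : nat) (x : 'rV['Z_q]_d) : bool :=
  [exists i, x 0 i \is a GRing.unit].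

Lemma card_Zq q : (1 < q)%N -> #|{: 'Z_q}| = q.
Proof. by move=> q_gt1; rewrite card_ord Zp_cast. Qed.

Section DotProduct.
Variables (q d : nat).
Implicit Types (x y z : 'rV['Z_q]_d) (a t : 'Z_q).

Lemma dotpDl x z y : dotp (x + z) y = dotp x y + dotp z y.
Proof. by rewrite -big_split; apply: eq_bigr => i _; rewrite mxE mulrDl. Qed.

Lemma dotpZl a x y : dotp (a *: x) y = a * dotp x y.
Proof. by rewrite mulr_sumr; apply: eq_bigr => i _; rewrite mxE mulrA. Qed.

Lemma dotpBr x y z : dotp x (y - z) = dotp x y - dotp x z.
Proof.
by rewrite -sumrB; apply: eq_bigr => i _; rewrite !mxE mulrBr.
Qed.

Lemma dotpZr a x y : dotp x (a *: y) = a * dotp x y.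
Proof. by rewrite mulr_sumr; apply: eq_bigr => i _; rewrite mxE mulrCA. Qed.

Lemma primitive_dotp1 y : primitive y -> exists e, dotp e y = 1.
Proof.
case/existsP=> i yi; exists ((y 0 i)^-1 *: delta_mx 0 i).
rewrite dotpZl /dotp (bigD1 i) //= big1 => [|k ki].
  by rewrite mxE !eqxx mul1r addr0 mulVr.
by rewrite mxE (negbTE ki) andbF mul0r.
Qed.

(** Translating by a vector e with e.y = 1 permutes the fibers of the dot
product with y, so they all have the same size. *)
Lemma card_dotp_fiber y t : (1 < q)%N -> primitive y ->
  (q * #|[set x | dotp x y == t]%SET| = #|{: 'rV['Z_q]_d}|)%N.
Proof.
move=> q_gt1 /primitive_dotp1 [e ey].
set F := finset _.
pose f (u : 'rV['Z_q]_d * 'Z_q) := u.1 + u.2 *: e.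
have f_inj : {in finset.setX F [set: 'Z_q]%SET &, injective f}.
  move=> [x a] [z b] /=; rewrite !inE /= !andbT => /eqP xt /eqP zt fE.
  have ab : a = b.
    have := congr1 (fun v => dotp v y) fE.
    by rewrite /f /= !dotpDl !dotpZl ey xt zt !mulr1 => /addrI.
  by congr pair => //; move: fE; rewrite /f /= ab => /addIr.
have fT : (f @: finset.setX F [set: 'Z_q] = [set: 'rV['Z_q]_d])%SET.
  apply/setP=> x; rewrite inE; apply/imsetP.
  exists (x + (t - dotp x y) *: e, dotp x y - t); last first.
    by rewrite /f /= -addrA -scalerDl -opprB addNr scale0r addr0.
  by rewrite !inE /= andbT dotpDl dotpZl ey mulr1 addrC subrK.
by rewrite -[RHS]cardsT -fT card_in_imset // cardsX cardsT card_Zq // mulnC.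
Qed.

End DotProduct.

(** * Divisibility by powers of p in Z/q and in (Z/q)^d *)

Section PrimePower.
Variables (p l d : nat).
Hypotheses (p_prime : prime p) (l_gt0 : (0 < l)%N).
Notation q := (p ^ l)%N.
Implicit Types (x y z w : 'rV['Z_q]_d) (a b t : 'Z_q).

Lemma q_gt1 : (1 < q)%N.
Proof. by rewrite -(exp1n l) ltn_exp2r // prime_gt1. Qed.

Lemma natr_val a : a = (a : nat)%:R.
Proof. by rewrite natr_Zp. Qed.

Lemma natr_Zq_eq0 n : ((n%:R : 'Z_q) == 0) = (q %| n)%N.
Proof. by rewrite -val_eqE /= val_Zp_nat ?q_gt1. Qed.

Lemma nonunitP a : reflect (exists b, a = p%:R * b) (a \isn't a GRing.unit).
Proof.
apply: (iffP idP) => [|[b ->]].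
  rewrite {1}[a]natr_val unitZpE ?q_gt1 // coprime_pexpl // prime_coprime //.
  rewrite negbK => /dvdnP [n an]; exists n%:R.
  by rewrite [LHS]natr_val an natrM mulrC.
by rewrite unitrM unitZpE ?q_gt1 // coprime_pexpl // prime_coprime // dvdnn.
Qed.

(** The nonunits form the maximal ideal generated by p. *)
Lemma nonunit_mul_sub t a b :
  t \is a GRing.unit -> b \isn't a GRing.unit -> t - a * b \is a GRing.unit.
Proof.
move=> t_unit /nonunitP [c ->]; apply: contraLR t_unit => /nonunitP [e te].
apply/nonunitP; exists (e + a * c).
by rewrite -[t](subrK (a * (p%:R * c))) te; ring.
Qed.

Lemma expp_mul_unit_neq0 j b : (j < l)%N -> b \is a GRing.unit ->
  p%:R ^+ j * b != 0 :> 'Z_q.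
Proof.
move=> j_lt b_unit; apply/eqP => /(congr1 (fun c => c / b)) /eqP.
rewrite mul0r mulrK // -natrX natr_Zq_eq0 dvdn_Pexp2l ?prime_gt1 //; lia.
Qed.

Lemma eq_mul_expp k m n : (k <= l)%N -> m = n %[mod p ^ (l - k)] ->
  p%:R ^+ k * m%:R = p%:R ^+ k * n%:R :> 'Z_q.
Proof.
move=> k_le mn; rewrite -natrX -!natrM; apply/val_inj.
rewrite /= !val_Zp_nat ?q_gt1 // -(subnKC k_le).
by rewrite expnD -!muln_modr mn.
Qed.

Definition multiples_set k : {set 'Z_q} := [set p%:R ^+ k * a | a : 'Z_q]%SET.

(** The multiple p^k a depends only on a modulo p^(l-k). *)
Lemma card_multiples k : (k <= l)%N -> (#|multiples_set k| <= p ^ (l - k))%N.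
Proof.
move=> k_le; rewrite -[leqRHS]card_ord -cardsT.
pose f (i : 'I_(p ^ (l - k))) : 'Z_q := p%:R ^+ k * i%:R.
apply: leq_trans _ (leq_imset_card f _).
apply/subset_leq_card/fintype.subsetP => _ /imsetP [a _ ->].
have r_lt : (a %% p ^ (l - k) < p ^ (l - k))%N.
  by rewrite ltn_mod expn_gt0 prime_gt0.
apply/imsetP; exists (Ordinal r_lt) => //.
by rewrite /f /= {1}(natr_val a); apply: eq_mul_expp; rewrite // modn_mod.
Qed.

Lemma torsion_sub_multiples k a : (k <= l)%N ->
  p%:R ^+ k * a = 0 -> a \in multiples_set (l - k).
Proof.
move=> k_le /eqP; rewrite {1}(natr_val a) -natrX -natrM natr_Zq_eq0.
rewrite -{1}(subnKC k_le) expnD dvdn_pmul2l ?expn_gt0 ?prime_gt0 //.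
move=> /dvdnP [n an]; apply/imsetP; exists n%:R => //.
by rewrite (natr_val a) an natrM natrX mulrC.
Qed.

Definition multiples_mx k : {set 'rV['Z_q]_d} :=
  [set p%:R ^+ k *: w | w : 'rV['Z_q]_d]%SET.

Lemma card_multiples_mx k : (k <= l)%N ->
  (#|multiples_mx k| <= p ^ ((l - k) * d))%N.
Proof.
move=> k_le; rewrite expnM.
have := card_ffun_on 'I_d (mem (multiples_set k)); rewrite card_ord => cardF.
apply: leq_trans (_ : (#|multiples_set k| ^ d <= _)%N); last first.
  by case: (posnP d) => [->|d_gt0]; rewrite // leq_exp2r // card_multiples.
rewrite -cardF.
pose f (g : {ffun 'I_d -> 'Z_q}) : 'rV['Z_q]_d := \row_i g i.
apply: leq_trans _ (leq_imset_card f _).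
apply/subset_leq_card/fintype.subsetP => _ /imsetP [w _ ->]; apply/imsetP.
exists [ffun i => p%:R ^+ k * w 0 i]; last first.
  by apply/rowP=> i; rewrite !mxE ffunE.
by apply/ffun_onP=> i; rewrite ffunE; apply: imset_f.
Qed.

Lemma nonprimitive_multiple w : ~~ primitive w -> exists w', w = p%:R *: w'.
Proof.
rewrite negb_exists => /forallP /(_ _) /nonunitP w_dvd.
have [g gE] := choice w_dvd.
by exists (\row_i g i); apply/rowP => i; rewrite !mxE gE.
Qed.

(** Here j is the largest exponent for which p^j divides z. *)
Lemma primitive_part z : z != 0 ->
  exists j w, [/\ (j < l)%N, primitive w & z = p%:R ^+ j *: w].
Proof.
move=> z_neq0.
have divs_lt j : z \in multiples_mx j -> (j < l)%N.
  move=> /imsetP [w _ zE]; rewrite ltnNge; apply: contra z_neq0 => l_le.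
  rewrite zE -(subnKC l_le) exprD -[p%:R ^+ l]natrX.
  by rewrite (eqP (_ : (q%:R : 'Z_q) == 0)) ?mul0r ?scale0r // natr_Zq_eq0.
have ex0 : exists j, z \in multiples_mx j.
  by exists 0%N; apply/imsetP; exists z; rewrite // scale1r.
have ub j : z \in multiples_mx j -> (j <= l)%N by move/divs_lt/ltnW.
case: (ex_maxnP ex0 ub) => j zj j_max; have j_lt := divs_lt j zj.
case/imsetP: zj => w _ zE; exists j, w; split => //.
apply: contraT => /nonprimitive_multiple [w' wE].
suff /j_max : z \in multiples_mx j.+1 by rewrite ltnn.
by apply/imsetP; exists w'; rewrite // exprSr -scalerA -wE.
Qed.

(** * Common solutions of two dot-product equations *)

(** Let x0 be a solution and let e.w = 1.  The pairs (x0.y, x0.w) and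
(e.y, e.w) = (e.y, 1) have determinant t - (e.y)(x0.w), which is a unit because
p divides x0.w (as p^j (x0.w) = 0 and j < l).  Hence adding combinations of x0
and e to a solution x moves (x.y, x.w) freely in (Z/q)^2: the vector
x + a x0 + b e, together with x.w, determines x, a and b.  As x.w is killed by
p^j, it takes at most p^j values. *)
Lemma card_common_fiber y w t j :
    (j < l)%N -> primitive w -> t \is a GRing.unit ->
  (q ^ 2 * #|[set x | (dotp x y == t) && (dotp x (p%:R ^+ j *: w) == 0%R)]%SET|
     <= #|{: 'rV['Z_q]_d}| * p ^ j)%N.
Proof.
move=> j_lt /primitive_dotp1 [e ew] t_unit; set S := finset _.
have [-> | [x0]] := set_0Vmem S; first by rewrite cards0 muln0.
rewrite inE dotpZr => /andP [/eqP x0y /eqP x0w].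
have x0w_nonunit : dotp x0 w \isn't a GRing.unit.
  by apply/negP => /(expp_mul_unit_neq0 j_lt); rewrite x0w eqxx.
have det_unit := nonunit_mul_sub (dotp e y) t_unit x0w_nonunit.
pose f (u : 'rV['Z_q]_d * ('Z_q * 'Z_q)) :=
  (u.1 + u.2.1 *: x0 + u.2.2 *: e, dotp u.1 w).
pose D := finset.setX S [set: 'Z_q * 'Z_q]%SET.
have f_inj : {in D &, injective f}.
  move=> [x [a b]] [x' [a' b']]; rewrite !inE /= !andbT.
  move=> /andP[/eqP xt _] /andP[/eqP xt' _] [vE wE].
  have := congr1 (fun v => dotp v y) vE; have := congr1 (fun v => dotp v w) vE.
  rewrite !dotpDl !dotpZl xt xt' x0y ew wE !mulr1 => Ew Ey.
  have aE : a = a'.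
    (* Cramer's rule eliminates b from the equations Ew and Ey. *)
    apply: (mulIr det_unit); apply/eqP; rewrite -subr_eq0.
    rewrite (_ : _ - _ = (t + a * t + b * dotp e y)
        - (t + a' * t + b' * dotp e y)
        - dotp e y * ((dotp x' w + a * dotp x0 w + b)
        - (dotp x' w + a' * dotp x0 w + b'))); last by ring.
    by rewrite Ew Ey !subrr mulr0 subrr.
  have bE : b = b'.
    by move: Ew; rewrite aE; apply: addrI.
  by move: vE; rewrite aE bE => /addIr /addIr ->.
have fD : (f @: D \subset
    finset.setX [set: 'rV['Z_q]_d] (multiples_set (l - j)))%SET.
  apply/fintype.subsetP=> _ /imsetP [[x u] xS ->]; rewrite !inE /=.
  apply: torsion_sub_multiples; first exact: ltnW.
  by move: xS; rewrite !inE /= andbT dotpZr => /andP[_ /eqP].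
have := subset_leq_card fD; rewrite card_in_imset // !cardsX !cardsT card_prod.
rewrite card_Zq ?q_gt1 // mulnC => /leq_trans -> //.
rewrite leq_mul2l; apply/orP; right.
by have := card_multiples (leq_subr j l); rewrite subKn // ltnW.
Qed.

(** If z - y = p^j w with w primitive and j < l, there are at most |T| p^j / q^2
common solutions.  The sum over k dominates its term k = j, and the summand 1
accounts for j = 0; for z = y the term k = l is used, since 0 is a multiple of
p^l.  Writing the bound over all k lets the pairs be summed by counting, for
each k, those congruent modulo p^k. *)
Lemma card_common_neighbours y z t : primitive y -> t \is a GRing.unit ->
  (q ^ 2 * #|[set x | (dotp x y == t) && (dotp x z == t)]%SET|
     <= #|{: 'rV['Z_q]_d}| *
        (1 + \sum_(1 <= k < l.+1) (z - y \in multiples_mx k)%R * p ^ k))%N.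
Proof.
move=> y_prim t_unit.
have setE : [set x | (dotp x y == t) && (dotp x z == t)]%SET =
    [set x | (dotp x y == t) && (dotp x (z - y) == 0)]%SET.
  apply/setP => x; rewrite !inE dotpBr subr_eq0.
  by have [-> | //] := eqVneq (dotp x y) t.
rewrite setE; have [-> | /primitive_part] := eqVneq (z - y) 0.
  rewrite (_ : finset _ = [set x | dotp x y == t]%SET); last first.
    apply/setP => x; rewrite !inE -[0](subrr y) dotpBr subrr eqxx.
    by rewrite andbT.
  rewrite expnS expn1 -mulnA card_dotp_fiber ?q_gt1 // mulnC leq_mul2l.
  rewrite big_nat_recr //= (_ : 0 \in _) ?mul1n; first by lia.
  by apply/imsetP; exists 0; rewrite // scaler0.
move=> [j [w [j_lt w_prim zE]]]; rewrite zE.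
apply: leq_trans (card_common_fiber _ j_lt w_prim t_unit) _.
rewrite leq_mul2l; apply/orP; right; have [-> | j_gt0] := posnP j.
  by rewrite expn0 leq_addr.
have j_mem : j \in index_iota 1 l.+1 by rewrite mem_index_iota j_gt0 ltnS ltnW.
rewrite (bigD1_seq j j_mem (iota_uniq _ _)) /= imset_f // mul1n.
by rewrite addnCA leq_addr.
Qed.

Lemma card_congruent_pairs (A : {set 'rV['Z_q]_d}) k : (k <= l)%N ->
  (\sum_(y in A) \sum_(z in A) ((z - y)%R \in multiples_mx k) <=
     #|A| * p ^ ((l - k) * d))%N.
Proof.
move=> k_le; rewrite -sum_nat_const; apply: leq_sum => y _.
apply: leq_trans (card_multiples_mx k_le).
rewrite -(card_imset _ (addIr y)) -sum1_card.
rewrite big_mkcond [leqRHS]big_mkcond; apply: leq_sum => z _ /=.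
case: (z \in A) => //; case: (boolP (_ \in multiples_mx k)) => // zy.
by rewrite (_ : z \in _) //; apply/imsetP; exists (z - y); rewrite ?subrK.
Qed.

(** * Sets that avoid a unit dot product *)

(** The summand 1 of [card_common_neighbours], summed over all pairs, gives
|T| |A|^2 and cancels the same term in [second_moment].  What is left is
|A|^3 <= |T| N, where N collects the congruent pairs; the positivity of d makes
k = 1 the worst congruence level. *)
Lemma card_primitive_avoiding (A : {set 'rV['Z_q]_d}) t :
    (0 < d)%N -> t \is a GRing.unit ->
    {in A, forall x, primitive x} -> {in A &, forall x y, dotp x y != t} ->
  (#|A| ^ 2 <= l * p ^ ((2 * l - 1) * d + 1))%N.
Proof.
move=> d_gt0 t_unit A_prim avoid.
have [-> | A_neq0] := posnP #|A|; first by rewrite exp0n.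
have cardT : #|{: 'rV['Z_q]_d}| = (p ^ (l * d))%N.
  by rewrite card_mx mul1n card_Zq ?q_gt1 // expnM.
pose N := (\sum_(1 <= k < l.+1) #|A| * p ^ ((l - k) * d) * p ^ k)%N.
have := @second_moment _ A (fun x y => dotp x y == t) q
  (fun y Ay => card_dotp_fiber t q_gt1 (A_prim y Ay)) avoid.
have pairs : (q ^ 2 * \sum_(y in A) \sum_(z in A)
     #|[set x | (dotp x y == t) && (dotp x z == t)]%SET| <=
    #|{: 'rV['Z_q]_d}| * (#|A| ^ 2 + N))%N.
  rewrite big_distrr /=.
  apply: (@leq_trans (\sum_(y in A) \sum_(z in A) #|{: 'rV['Z_q]_d}| *
      (1 + \sum_(1 <= k < l.+1) (z - y \in multiples_mx k)%R * p ^ k))).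
    apply: leq_sum => y Ay; rewrite big_distrr /=; apply: leq_sum => z _.
    by apply: card_common_neighbours => //; apply: A_prim.
  under eq_bigr => y _ do rewrite -big_distrr /= big_split /= sum1_card.
  rewrite -big_distrr /= big_split /= sum_nat_const leq_mul2l.
  apply/orP; right; rewrite leq_add2l.
  under eq_bigr => y _ do rewrite exchange_big /=.
  rewrite exchange_big /= /N !big_nat; apply: leq_sum => k /andP[_ k_le].
  under eq_bigr => y _ do rewrite -big_distrl /=.
  by rewrite -big_distrl leq_mul2r card_congruent_pairs ?orbT.
have N_le : (N <= #|A| * (l * p ^ ((l - 1) * d + 1)))%N.
  rewrite /N big_nat.
  apply: (@leq_trans (\sum_(1 <= k < l.+1) #|A| * p ^ ((l - 1) * d + 1))%N).
    rewrite [leqRHS]big_nat; apply: leq_sum => k /andP[k_gt0 k_le].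
    rewrite -mulnA -expnD leq_mul2l leq_exp2l ?prime_gt1 //; apply/orP; right.
    by nia.
  by rewrite sum_nat_const_nat subn1 /= mulnCA.
have -> : (p ^ ((2 * l - 1) * d + 1) = p ^ (l * d) * p ^ ((l - 1) * d + 1))%N.
  by rewrite -expnD addnA -mulnDl; congr (p ^ (_ * d + 1))%N; lia.
rewrite -cardT => moment.
have {}moment : (#|A| ^ 3 <= #|{: 'rV['Z_q]_d}| * N)%N.
  have := leq_trans moment pairs.
  by rewrite mulnDr addnC [(#|A| ^ 2 * _)%N]mulnC leq_add2l.
rewrite -(leq_pmul2l A_neq0) -expnS; apply: leq_trans moment _.
by rewrite (mulnCA l) (mulnCA #|A|) leq_mul2l N_le orbT.
Qed.

Lemma card_avoiding (E : {set 'rV['Z_q]_d}) t :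
    (0 < d)%N -> t \is a GRing.unit -> t \notin dotp_set E ->
  (#|E| ^ 2 <= (2 * l) ^ 2 * p ^ ((2 * l - 1) * d + 1))%N.
Proof.
move=> d_gt0 t_unit tE.
pose A := [set x in E | primitive x]%SET.
have A_le : (#|A| ^ 2 <= l * p ^ ((2 * l - 1) * d + 1))%N.
  apply: card_primitive_avoiding t_unit _ _ => // [x|x y].
    by rewrite inE => /andP[].
  rewrite !inE => /andP[Ex _] /andP[Ey _]; apply: contraNneq tE => <-.
  by apply/imset2P; exists x y.
have B_le : (#|(E :\: A)%SET| <= p ^ ((l - 1) * d))%N.
  apply: leq_trans (card_multiples_mx l_gt0).
  apply/subset_leq_card/fintype.subsetP => x; rewrite !inE => /andP[].
  case: (x \in E) => //= /nonprimitive_multiple [w ->] _.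
  by rewrite -[p%:R]expr1 imset_f.
have B2_le : (#|(E :\: A)%SET| ^ 2 <= p ^ ((2 * l - 1) * d + 1))%N.
  apply: (@leq_trans ((p ^ ((l - 1) * d)) ^ 2)); first by rewrite leq_exp2r.
  by rewrite -expnM leq_exp2l ?prime_gt1 //; nia.
have -> : #|E| = (#|A| + #|(E :\: A)%SET|)%N.
  rewrite -(cardsID A E); congr addn; apply: eq_card => x.
  by rewrite !inE; case: (x \in E).
(* With M = p^((2l-1)d+1): (a + b)^2 <= 2 (a^2 + b^2) <= 2 (l + 1) M, and
   2 (l + 1) <= (2 l)^2 because l >= 1. *)
apply: (@leq_trans (2 * (#|A| ^ 2 + #|(E :\: A)%SET| ^ 2))).
  rewrite sqrnD [leqRHS]mul2n -addnn leq_add2l; exact: nat_Cauchy.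
apply: leq_trans (leq_mul (leqnn 2) (leq_add A_le B2_le)) _.
rewrite -mulSnr mulnA leq_mul2r; apply/orP; right; nia.
Qed.

End PrimePower.

(** * The asymptotic statement *)

Lemma powR_threshold_sqr (R : realType) (p l d : nat) : (0 < l)%N ->
  ((p ^ l)%N%:R `^ ((2 * l%:R - 1) * d%:R / (2 * l%:R) + 1 / (2 * l%:R))) ^+ 2
    = (p ^ ((2 * l - 1) * d + 1))%N%:R :> R.
Proof.
move=> l_gt0.
have l_neq0 : (l%:R : R) != 0 by rewrite pnatr_eq0 -lt0n.
rewrite -powR_mulrn ?powR_ge0 // -powRrM natrX -powR_mulrn ?ler0n // -powRrM.
rewrite natrX -[RHS]powR_mulrn ?ler0n //; congr powR.
by rewrite natrD natrM natrB ?muln_gt0 // natrM; field.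
Qed.

Theorem theorem1p3p2 (R : realType) (d : nat) (hd : (0 < d)%N)
    (p l : nat -> nat)
    (hp : forall n, prime (p n)) (hodd : forall n, odd (p n))
    (hl : forall n, (0 < l n)%N)
    (E : forall n, {set 'rV['Z_(p n ^ l n)]_d})
    (hE : (fun n => (l n)%:R *
             ((p n ^ l n)%N%:R : R) `^
               ((2 * (l n)%:R - 1) * d%:R / (2 * (l n)%:R)
                + 1 / (2 * (l n)%:R)))
          =o_\oo (fun n => #|E n|%:R : R)) :
  \forall n \near \oo,
    [set u : 'Z_(p n ^ l n) | u \is a GRing.unit]%SET \subset dotp_set (E n).
Proof.
have quarter : 0 < 4^-1 :> R by rewrite invr_gt0.
have /eqoP /(_ _ quarter) small := hE.
near=> n.
have : `|(l n)%:R * ((p n ^ l n)%N%:R : R) `^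
      ((2 * (l n)%:R - 1) * d%:R / (2 * (l n)%:R) + 1 / (2 * (l n)%:R))|
    <= 4^-1 * `|(#|E n|%:R : R)| by near: n.
set X := _ `^ _; rewrite normrM !normr_nat => X_le.
have X_gt0 : 0 < X by rewrite powR_gt0 // ltr0n expn_gt0 prime_gt0.
rewrite gtr0_norm // in X_le.
apply/fintype.subsetP => t; rewrite inE => t_unit; apply: contraT => tE.
have E_le : (#|E n|%:R : R) ^+ 2 <= (2 * (l n)%:R) ^+ 2 * X ^+ 2.
  rewrite powR_threshold_sqr // -natrM -!natrX -natrM ler_nat.
  exact: card_avoiding t_unit tE.
have l_ge1 : 1 <= (l n)%:R :> R by rewrite ler1n.
have lX_gt0 : 0 < (l n)%:R * X by rewrite mulr_gt0 // (lt_le_trans ltr01).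
by clear - X_le E_le lX_gt0; nra.
Unshelve. all: by end_near.
Qed.
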